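(* Suppose $\Omega=\bigcup_{i=1}^n(\alpha_i,\beta_i)$, with $-\infty<\alpha_1<\beta_1<\alpha_2<\beta_2<\dots<\alpha_n<\beta_n<\infty$, has a spectrum with period $p$. Then there exist numbers $k_i\in\frac1p\mathbb{Z}$, $i=1,\dots,n$, such that $\Omega':=\bigcup_{i=1}^n[\alpha_i-k_i,\beta_i-k_i)$ is a disjoint union and $\Omega'$ is a disjoint union of intervals with lengths in $\frac1p\mathbb{Z}$.
   Context: A set $\Lambda\subset\mathbb{R}$ is a spectrum for $\Omega$ if $\{|\Omega|^{-1/2}e_\lambda:\lambda\in\Lambda\}$ is an orthonormal basis of $L^2(\Omega)$, where $e_\lambda(x)=e^{2\pi \mathrm{i}\lambda x}$ and $|\Omega|$ is Lebesgue measure. $\Lambda$ has period $p\in\mathbb{R}\setminus\{0\}$ if $\Lambda+p=\Lambda$. *)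

(* Defs.v *)
From mathcomp Require Import all_boot all_order all_algebra.
From mathcomp Require Import all_classical all_reals all_analysis.
From mathcomp Require Import complex.

Set Implicit Arguments.
Unset Strict Implicit.
Unset Printing Implicit Defensive.

Import Order.TTheory GRing.Theory Num.Theory.
Import numFieldNormedType.Exports.

Local Open Scope classical_set_scope.
Local Open Scope ring_scope.
Local Open Scope complex_scope.

Section ComplexL2.
Context {R : realType}.
Local Notation mu := (@lebesgue_measure R).
Implicit Types (D : set R) (f g : R -> R[i]).

Definition cintegral D f : R[i] :=
  (\int[mu]_(x in D) complex.Re (f x)) +i*
  (\int[mu]_(x in D) complex.Im (f x)).

Definition l2norm_sq D f : \bar R :=
  (\int[mu]_(x in D) (Normc.normc (f x) ^+ 2)%:E)%E.

(* Elements of L^2(D) are represented by functions; functions equal almost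
   everywhere on D represent the same element. *)
Definition in_L2 D f : Prop :=
  [/\ measurable_fun (D : set (measurableTypeR R)) (fun x => complex.Re (f x)),
      measurable_fun (D : set (measurableTypeR R)) (fun x => complex.Im (f x)) &
      (l2norm_sq D f < +oo)%E].

Definition l2inner D f g : R[i] := cintegral D (fun x => f x * conjc (g x)).

Definition orthonormal_in_L2 (I : eqType) D (A : set I) (u : I -> R -> R[i]) :=
  (forall i, A i -> in_L2 D (u i)) /\
  (forall i j, A i -> A j -> l2inner D (u i) (u j) = (i == j)%:R).

Definition total_in_L2 (I : eqType) D (A : set I) (u : I -> R -> R[i]) :=
  forall f, in_L2 D f -> forall eps : R, 0 < eps ->
  exists (s : seq I) (c : I -> R[i]),
    (forall i, i \in s -> A i) /\
    (l2norm_sq D (fun x => f x - \sum_(i <- s) c i * u i x)%R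
       < (eps ^+ 2)%:E)%E.

Definition orthonormal_basis_L2 (I : eqType) D (A : set I)
    (u : I -> R -> R[i]) :=
  orthonormal_in_L2 D A u /\ total_in_L2 D A u.

(* e_la(x) = exp (2 pi i la x) *)
Definition expchar (la x : R) : R[i] :=
  cos (2 * pi * la * x) +i* sin (2 * pi * la * x).

Definition is_spectrum D (L : set R) : Prop :=
  orthonormal_basis_L2 D L
    (fun la x => ((Num.sqrt (fine (mu D)))^-1)%:C * expchar la x).

End ComplexL2.

Definition has_period {R : realType} (L : set R) (p : R) : Prop :=
  p != 0 /\ [set la + p | la in L] = L.

(* (1/p) Z *)
Definition inv_lattice {R : realType} (p : R) : set R :=
  [set m%:~R / p | m in [set: int]].

(* Main.v *)
Require Import Defs.
From mathcomp Require Import all_boot all_order all_algebra.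
From mathcomp Require Import perm.
From mathcomp Require Import all_classical all_reals all_analysis.
From mathcomp Require Import measurable_realfun complex lra ring.

(** If [la] is in the spectrum then so is [la + m p], so orthogonality gives
    [\int_Omega e(m p x) dx = 0] for all [m >= 1], that is, the numbers
    [e(p beta_i)] and [e(p alpha_i)] have the same [m]-th power sums. They
    therefore agree as multisets, which yields a permutation [sigma] with
    [beta_i - alpha_(sigma i)] in [(1/p) Z]. Translating by [(1/p) Z], the
    intervals along a cycle of [sigma] can be glued end to end; the cycle closes
    up, so the resulting interval has length in [(1/p) Z]. *)

Import Order.TTheory GRing.Theory Num.Theory.
Import numFieldNormedType.Exports.

Local Open Scope classical_set_scope.
Local Open Scope ring_scope.

(** * Power sums determine a finite multiset *)

Lemma sum_horner_power_sums (F : comNzRingType) (s : seq F) (P : {poly F}) :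
  \sum_(x <- s) P.[x] = \sum_(i < size P) P`_i * \sum_(x <- s) x ^+ i.
Proof.
under eq_bigr do rewrite horner_coef.
by rewrite exchange_big; apply: eq_bigr => i _; rewrite big_distrr.
Qed.

(** By linearity, equal power sums give equal sums of [P.[x]] for every polynomial [P]. Taking [P]
    to vanish at all entries other than [u] isolates the multiplicity of [u]. *)
Lemma power_sums_perm_eq (F : numDomainType) (s t : seq F) :
  (forall m, \sum_(x <- s) x ^+ m = \sum_(x <- t) x ^+ m) -> perm_eq s t.
Proof.
move=> st; apply/allP => u; rewrite mem_cat => ust /=.
pose l := rem u (undup (s ++ t)).
pose P : {poly F} := \prod_(v <- l) ('X - v%:P).
have l_mem v : (v \in l) = (v != u) && (v \in s ++ t).
  by rewrite /l rem_filter ?undup_uniq // mem_filter mem_undup.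
have Pu0 : P.[u] != 0.
  by rewrite -[_ == 0]/(root P u) root_prod_XsubC l_mem eqxx.
have sumP (r : seq F) : {subset r <= s ++ t} ->
    \sum_(x <- r) P.[x] = P.[u] *+ count_mem u r.
  move=> rst; rewrite (bigID (pred1 u)) /= [X in _ + X = _]big_seq_cond.
  rewrite [X in _ + X = _]big1 => [|x /andP[/rst xst xu]]; last first.
    by apply/eqP; rewrite -[_ == 0]/(root P x) root_prod_XsubC l_mem xu.
  rewrite addr0 (eq_bigr (fun=> P.[u])) => [|x /eqP-> //].
  by rewrite big_const_seq iter_addr addr0.
have : P.[u] *+ count_mem u s = P.[u] *+ count_mem u t.
  rewrite -!sumP; try by move=> x xr; rewrite mem_cat xr ?orbT.
  by rewrite !sum_horner_power_sums; apply: eq_bigr => i _; rewrite st.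
(* Characteristic zero: the multiples of the nonzero [P.[u]] are pairwise distinct. *)
by move/(mulrIn Pu0)/eqP.
Qed.

(** * Gluing intervals along the cycles of a permutation *)

Section Rearrangement.
Variables (R : realDomainType) (L : set R).
(** [L] abstracts the lattice (1/p)Z: an additive subgroup with arbitrarily large elements. *)
Hypothesis L_sub : forall x y, L x -> L y -> L (x - y).
Hypothesis L_unbounded : forall B, exists2 q, L q & B <= q.
Variables (n : nat) (a b : 'I_n -> R) (sigma : {perm 'I_n}).
Hypothesis a_lt_b : forall i, a i < b i.
Hypothesis glue : forall i, L (b i - a (sigma i)).

Let L0 : L 0.
Proof. by have [q Lq _] := L_unbounded 0; rewrite -(subrr q); exact: L_sub. Qed.

Let L_opp x : L x -> L (- x).
Proof. by move=> Lx; rewrite -sub0r; exact: L_sub. Qed.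

Let L_add x y : L x -> L y -> L (x + y).
Proof. by move=> Lx /L_opp Ly; rewrite -[y]opprK; exact: L_sub. Qed.

Let len i := b i - a i.

(** The offset at which the interval of index [iter t sigma r] starts when those of [r], [sigma r],
    ... are laid end to end. *)
Let chain_len r t := \sum_(s < t) len (iter s sigma r).

Let chain_lenS r t : chain_len r t.+1 = chain_len r t + len (iter t sigma r).
Proof. by rewrite /chain_len big_ord_recr. Qed.

Let len_gt0 i : 0 < len i. Proof. by rewrite subr_gt0. Qed.

Let chain_len_homo r s t : (s <= t)%N -> chain_len r s <= chain_len r t.
Proof.
elim: t => [|t IH]; first by rewrite leqn0 => /eqP->.
rewrite leq_eqVlt => /orP[/eqP->//|/IH{}IH].
by rewrite chain_lenS (le_trans IH)// lerDl ltW.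
Qed.

Let chain_len_cover r t x : 0 <= x < chain_len r t ->
  exists2 s, (s < t)%N & chain_len r s <= x < chain_len r s.+1.
Proof.
elim: t => [|t IH] /andP[x0 xt].
  by move: (le_lt_trans x0 xt); rewrite /chain_len big_ord0 ltxx.
have [xt'|tx] := ltP x (chain_len r t).
  by have [|s st xs] := IH; [rewrite x0 | exists s => //; exact: ltnW].
by exists t => //; rewrite tx.
Qed.

Let chain_len_inj r s t x : chain_len r s <= x < chain_len r s.+1 ->
  chain_len r t <= x < chain_len r t.+1 -> s = t.
Proof.
move=> /andP[s1 s2] /andP[t1 t2]; apply/eqP; rewrite eqn_leq.
apply/andP; split; rewrite leqNgt; apply/negP => /(chain_len_homo r) h.
- by move: (lt_le_trans (lt_le_trans t2 h) s1); rewrite ltxx.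
- by move: (lt_le_trans (lt_le_trans s2 h) t1); rewrite ltxx.
Qed.

(** Moving an interval to its place in the chain that starts at [a r] is a translation by an element
    of [L]: each further link changes the translation by some [b i - a (sigma i)]. *)
Let chain_lattice r t : L (a (iter t sigma r) - a r - chain_len r t).
Proof.
elim: t => [|t IH]; first by rewrite /chain_len big_ord0 /= subrr subr0.
rewrite chain_lenS /= /len.
set i := iter t sigma r in IH *.
rewrite (_ : _ - _ = (a i - a r - chain_len r t) - (b i - a (sigma i))).
  exact: L_sub.
by lra.
Qed.

(** A chosen representative of the cycle of [i]; [findex] then gives the position of [i] on the
    cycle read from there. *)
Let rt i := froot sigma i.
Let chain_rt i : iter (findex sigma (rt i) i) sigma (rt i) = i.
Proof.
apply: iter_findex; rewrite (fconnect_sym (perm_inj (s := sigma))).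
exact: connect_root.
Qed.

Let fidx_lt i : (findex sigma (rt i) i < fingraph.order sigma (rt i))%N.
Proof.
apply: findex_max; rewrite (fconnect_sym (perm_inj (s := sigma))).
exact: connect_root.
Qed.

Let total r := chain_len r (fingraph.order sigma r).

(** After a full turn the iterate is [r] again, so the two left endpoints in [chain_lattice]
    cancel. *)
Let total_lattice r : L (total r).
Proof.
have := chain_lattice r (fingraph.order sigma r).
rewrite (iter_order (perm_inj (s := sigma))) subrr sub0r -/(total r).
by move/L_opp; rewrite opprK.
Qed.

(* The cycles of sigma are kept apart by shifting them by distinct multiples of
   an element of L exceeding the diameter of the whole configuration. *)
Lemma rearrange_along_cycles :
  exists k : 'I_n -> R,
    [/\ forall i, L (k i),
        trivIset [set: 'I_n] (fun i => [set` `[a i - k i, b i - k i[]) &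
        exists (m : nat) (c d : 'I_m -> R),
          [/\ forall j, c j < d j,
              forall j, L (d j - c j),
              trivIset [set: 'I_m] (fun j => [set` `[c j, d j[]) &
              \bigcup_(i in [set: 'I_n]) [set` `[a i - k i, b i - k i[] =
              \bigcup_(j in [set: 'I_m]) [set` `[c j, d j[]]].
Proof.
(* The factor 2 leaves room for the left endpoints of two indices, possibly equal, in [q_sep]. *)
have [q Lq qB] := L_unbounded (\sum_i (`|a i| *+ 2 + total i)).
have total_ge0 r : 0 <= total r by apply: sumr_ge0 => i _; exact: ltW.
have q_sep (r r' : 'I_n) : a r + total r - a r' <= q.
  have bnd (f : 'I_n -> R) s : (forall i, 0 <= f i) -> f s <= \sum_i f i.
    by move=> f0; rewrite (bigD1 s) //= lerDl sumr_ge0.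
  apply: le_trans qB; rewrite big_split /= sumrMnl mulr2n.
  have h1 := bnd _ r (fun i => normr_ge0 (a i)).
  have h2 := bnd _ r' (fun i => normr_ge0 (a i)).
  have h3 := bnd _ r total_ge0.
  have h4 := ler_norm (a r); have := ler_norm (- a r'); rewrite normrN => h5.
  by lra.
have q_ge0 : 0 <= q.
  by apply: le_trans qB; apply: sumr_ge0 => i _; rewrite addr_ge0 ?mulrn_wge0.
have Lqn m : L (q *+ m) by elim: m => // m IH; rewrite mulrS; exact: L_add.
(* The cycle with representative [r] will fill the slot from [base r] to [base r + total r]. *)
pose base (r : 'I_n) := a r + q *+ r.
have base_sep (r r' : 'I_n) : (r < r')%N -> base r + total r <= base r'.
  move=> rr'; have h1 := q_sep r r'.
  have : q *+ r.+1 <= q *+ r' by rewrite ler_wpMn2l.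
  by rewrite mulrS /base => h2; lra.
have base_inj (r r' : 'I_n) x : base r <= x < base r + total r ->
    base r' <= x < base r' + total r' -> r = r'.
  move=> /andP[r1 r2] /andP[s1 s2]; apply: val_inj.
  by case: (ltngtP r r') => // /base_sep h; exfalso; lra.
pose t i := findex sigma (rt i) i.
(* Chosen so that the translated interval starts at its offset inside the slot of its cycle. *)
pose k i := a i - (base (rt i) + chain_len (rt i) (t i)).
have akE i : a i - k i = base (rt i) + chain_len (rt i) (t i).
  by rewrite /k; lra.
have bkE i : b i - k i = base (rt i) + chain_len (rt i) (t i).+1.
  by rewrite chain_lenS chain_rt /k /len; lra.
have memE i x : (x \in `[a i - k i, b i - k i[) =
    (chain_len (rt i) (t i) <= x - base (rt i) < chain_len (rt i) (t i).+1).
  by rewrite in_itv /= akE bkE lerBrDl ltrBlDl.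
have mem_base i x : x \in `[a i - k i, b i - k i[ ->
    base (rt i) <= x < base (rt i) + total (rt i).
  rewrite memE => /andP[h1 h2].
  have h3 := chain_len_homo (rt i) _ _ (fidx_lt i).
  have h4 := chain_len_homo (rt i) _ _ (leq0n (t i)).
  rewrite /chain_len big_ord0 -/(chain_len _ _) in h4.
  rewrite /total -/(t i) in h3 *.
  by apply/andP; split; lra.
exists k; split.
- move=> i; rewrite /k /base.
  have := L_sub _ _ (chain_lattice (rt i) (t i)) (Lqn (rt i)).
  by rewrite chain_rt; congr L; lra.
(* A common point lies in one slot only, which fixes the cycle; its offset in the slot then fixes
   the position on the cycle. *)
- move=> i j _ _ [x [/= xi xj]].
  have rij := base_inj _ _ _ (mem_base _ _ xi) (mem_base _ _ xj).
  rewrite memE in xi; rewrite memE -rij in xj.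
  rewrite -(chain_rt j) -/(t j) -rij -(chain_len_inj _ _ _ _ xi xj).
  exact/esym/chain_rt.
(* One glued interval per cycle, indexed by the representatives. *)
pose roots := [set r : 'I_n | rt r == r]%SET.
exists #|roots|, (fun j => base (enum_val j)),
  (fun j => base (enum_val j) + total (enum_val j)); split.
- move=> j; rewrite ltrDl; set r := enum_val j.
  rewrite /total -(prednK (fingraph.order_gt0 sigma r)) chain_lenS.
  by apply: ltr_wpDl => //; apply: sumr_ge0 => s _; exact: ltW.
- by move=> j; rewrite addrAC subrr add0r.
- move=> j j' _ _ [x [/=]]; rewrite !in_itv /= => xj xj'.
  exact/enum_val_inj/(base_inj _ _ _ xj xj').
apply/seteqP; split=> x [i _ /=].
- move=> /mem_base xi.
  have ri : rt i \in roots.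
    by rewrite inE /rt (root_root (fconnect_sym (perm_inj (s := sigma)))).
  by exists (enum_rank_in ri (rt i)) => //=; rewrite enum_rankK_in // in_itv.
have := enum_valP i; set r := enum_val i; rewrite inE => /eqP rr.
rewrite in_itv /= => /andP[x1 x2].
have [|s sr xs] := chain_len_cover r (fingraph.order sigma r) (x - base r).
  by rewrite -/(total r); apply/andP; split; lra.
exists (iter s sigma r) => //=; rewrite memE.
have rtE : rt (iter s sigma r) = r.
  rewrite -[RHS]rr; apply/esym/eqP.
  rewrite (root_connect (fconnect_sym (perm_inj (s := sigma)))).
  exact: fconnect_iter.
(* Since [s] is below the order of the cycle, [findex] recovers exactly [s]. *)
by rewrite /t rtE findex_iter.
Qed.

End Rearrangement.

(** * Exponentials: functional equations and kernel *)

Section Expchar.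
Variable R : realType.
Implicit Types x y t : R.

Lemma expcharDr (la x y : R) : expchar la (x + y) = expchar la x * expchar la y.
Proof.
apply/eqP; rewrite eq_complex /= mulrDr cosD sinD.
by apply/andP; split; apply/eqP; ring.
Qed.

Lemma expcharN (la x : R) : expchar (- la) x = conjc (expchar la x).
Proof. by apply/eqP; rewrite eq_complex /= mulrN mulNr cosN sinN !eqxx. Qed.

Lemma expcharDl (la mu x : R) :
  expchar (la + mu) x = expchar la x * expchar mu x.
Proof.
apply/eqP; rewrite eq_complex /= mulrDr mulrDl cosD sinD.
by apply/andP; split; apply/eqP; ring.
Qed.

Lemma expchar_natl (la x : R) m : expchar (la *+ m) x = expchar la x ^+ m.
Proof.
elim: m => [|m IH]; last by rewrite mulrS expcharDl IH exprS.
by apply/eqP; rewrite eq_complex /= mulr0 mul0r cos0 sin0 !eqxx.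
Qed.

Lemma expchar_intl_1 (z : int) : expchar z%:~R (1 : R) = 1.
Proof.
have nat1 m : expchar m%:R (1 : R) = 1.
  rewrite expchar_natl (_ : expchar 1 1 = 1) ?expr1n //.
  have e : 2 * pi * 1 * 1 = pi *+ 2 :> R by rewrite !mulr1 mulr_natl.
  by apply/eqP; rewrite eq_complex /= e cos2pi sin2pi !eqxx.
case: z => m; first exact: nat1.
rewrite NegzE mulrNz expcharN nat1; apply/eqP.
by rewrite eq_complex /= oppr0 !eqxx.
Qed.

(** The fractional part [s] of [t] still satisfies cos(2 pi s) = 1, so sin(pi s) = 0 by the
    double-angle formula; as sine is positive between 0 and pi, [s] is 0. *)
Lemma expchar_eq1 t : expchar t 1 = 1 -> exists z : int, t = z%:~R.
Proof.
move=> t1; exists (Num.floor t); apply/eqP; rewrite -subr_eq0; apply/eqP.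
set s := t - _.
have s0 : 0 <= s by rewrite subr_ge0 floor_le.
have s1 : s < 1.
  by have /andP[_] := floor_itv t; rewrite intrD /s => h; lra.
have es : expchar s 1 = 1.
  by rewrite /s expcharDl t1 -mulrNz expchar_intl_1 mulr1.
have cs : cos ((pi * s) *+ 2) = 1.
  move/eqP: es; rewrite eq_complex /= => /andP[/eqP + _].
  by rewrite mulr1 -mulrA mulr_natl.
have ss : sin (pi * s) = 0.
  move: cs; rewrite cos_mulr2n cos2sin2 => cs; apply/eqP.
  by rewrite -sqrf_eq0; apply/eqP; lra.
apply/eqP; apply: contraT => sn0.
have sp : 0 < s by rewrite lt_neqAle eq_sym sn0.
have : 0 < sin (pi * s).
  apply: sin_gt0_pi; rewrite mulr_gt0 ?pi_gt0 //=.
  by rewrite gtr_pMr // pi_gt0.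
by rewrite ss ltxx.
Qed.

Lemma expchar_inj (p x y : R) : p != 0 -> expchar p x = expchar p y ->
  inv_lattice p (x - y).
Proof.
move=> p0 xy.
have [z zE] : exists z : int, p * (x - y) = z%:~R.
  apply: expchar_eq1.
  (* An exponential depends only on the product of frequency and point, so the two may trade
     places. *)
  transitivity (expchar p (x - y)).
    by rewrite /expchar !mulr1 !mulrA.
  rewrite expcharDr xy -expcharDr subrr.
  by apply/eqP; rewrite eq_complex /= mulr0 cos0 sin0 !eqxx.
by exists z => //; rewrite -zE mulrC mulKf.
Qed.

End Expchar.

(** * Integrals of continuous functions over bounded sets *)

Section Integrals.
Variable R : realType.
Local Notation mu := (@lebesgue_measure R).

Lemma continuous_cos_mull (t : R) : continuous (fun x : R => cos (t * x)).
Proof.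
move=> x; apply: continuous_comp; first exact: mulrl_continuous.
exact: continuous_cos.
Qed.

Lemma continuous_sin_mull (t : R) : continuous (fun x : R => sin (t * x)).
Proof.
move=> x; apply: continuous_comp; first exact: mulrl_continuous.
exact: continuous_sin.
Qed.

Lemma integrable_bounded_set (D : set R) (f : R -> R) (M : R) :
  measurable D -> D `<=` `[-M, M] -> continuous f ->
  mu.-integrable D (EFin \o f).
Proof.
move=> mD DM cf; apply: (@integrableS _ _ _ mu `[-M, M]) => //.
apply: continuous_compact_integrable; first exact: segment_compact.
by apply: continuous_subspaceT => x; exact: cf.
Qed.

Lemma Rintegral_oo_FTC2 (f F : R -> R) (a b : R) : a < b -> continuous f ->
  (forall x, is_derive x (1 : R) F (f x)) ->
  \int[mu]_(x in `]a, b[) f x = F b - F a.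
Proof.
move=> ab cf dF.
(* The endpoints are null sets, so they are added one at a time to reach [[a, b]], where the
   fundamental theorem of calculus applies. *)
have intf : mu.-integrable [set` Interval (BRight a) (BRight b)] (EFin \o f).
  apply: (@integrableS _ _ _ mu `[a, b]) => //; first exact: subset_itv_oc_cc.
  apply: continuous_compact_integrable; first exact: segment_compact.
  by apply: continuous_subspaceT => x; exact: cf.
rewrite Rintegral_itv_bndo_bndc; last first.
  by apply: integrableS intf => //; exact: subset_itv_oo_oc.
rewrite Rintegral_itv_obnd_cbnd //.
have cF : continuous F.
  by move=> x; apply/differentiable_continuous/derivable1_diffP/ex_derive.
rewrite /Rintegral (@continuous_FTC2 _ f F) //.
- by apply: continuous_subspaceT => x; exact: cf.
- split; first by move=> x _; exact: ex_derive.
  + exact/cvg_at_right_filter/cF.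
  + exact/cvg_at_left_filter/cF.
- by move=> x _; rewrite derive1E derive_val.
Qed.

Lemma Rintegral_bigcup_ord n (D : 'I_n -> set R) (f : R -> R) :
  (forall i, measurable (D i)) -> trivIset setT D ->
  (forall i, mu.-integrable (D i) (EFin \o f)) -> measurable_fun setT f ->
  \int[mu]_(x in \bigcup_(i in setT) D i) f x = \sum_i \int[mu]_(x in D i) f x.
Proof.
move=> mD tD iD mf.
have eT : [set: 'I_n] = [set` index_enum 'I_n].
  by apply/seteqP; split => i //= _; rewrite mem_index_enum.
rewrite /Rintegral eT bigcup_seq integral_bigsetU_EFin //=.
- rewrite sum_fine //= => i _.
  by apply: integrable_fin_num => //; exact: mD.
- exact: index_enum_uniq.
- by rewrite -eT.
- by apply/measurable_EFinP; apply: measurable_funS mf.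
Qed.

End Integrals.

(** * Orthogonality of a spectrum and its effect on the endpoints *)

Section Spectrum.
Variable R : realType.
Local Notation mu := (@lebesgue_measure R).
Implicit Types (D L : set R).

(** With no frequencies the only approximant is 0, whose squared distance to the constant 1 is
    [mu D]; the tolerance is chosen with square exactly [mu D], which the strict bound forbids. *)
Lemma spectrum_nonempty D L : measurable D -> (0 < mu D < +oo)%E ->
  is_spectrum D L -> L !=set0.
Proof.
move=> mD /andP[D0 Doo] [_ tot].
have norm1 : l2norm_sq D (fun=> 1) = mu D.
  rewrite /l2norm_sq /=.
  under eq_integral do rewrite expr0n addr0 expr1n sqrtr1 expr1n.
  by rewrite integral_cst // mul1e.
have inL2 : in_L2 D (fun=> 1).
  by split; [exact: measurable_cst | exact: measurable_cst | rewrite norm1].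
have fD : (fine (mu D))%:E = mu D by rewrite fineK // ge0_fin_numE // ltW.
have fD0 : 0 < fine (mu D) by rewrite -lte_fin fD.
have [|[|i s] [c [sL]]] := tot _ inL2 (Num.sqrt (fine (mu D))).
- by rewrite sqrtr_gt0.
- under [X in l2norm_sq _ X]eq_fun do rewrite big_nil subr0.
  by rewrite norm1 sqr_sqrtr ?ltW // fD ltxx.
- by move=> _; exists i; apply: sL; rewrite mem_head.
Qed.

Lemma spectrum_orthogonal D L (M la la' : R) :
  measurable D -> D `<=` `[-M, M] ->
  is_spectrum D L -> L la -> L la' -> la != la' ->
  cintegral D (expchar (la - la')) = 0.
Proof.
move=> mD DM [[_ orth] _] Lla Lla' neq.
set c := (Num.sqrt (fine (mu D)))^-1 in orth.
have ccos := @continuous_cos_mull R.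
have csin := @continuous_sin_mull R.
have innerE l l' : l2inner D (fun x => (c%:C * expchar l x)%C)
      (fun x => (c%:C * expchar l' x)%C) =
    ((c ^+ 2)%:C)%C * cintegral D (expchar (l - l')).
  rewrite /l2inner /cintegral.
  have E x : (c%:C * expchar l x * conjc (c%:C * expchar l' x) =
      (c ^+ 2)%:C * expchar (l - l') x)%C.
    rewrite expcharDl expcharN; apply/eqP; rewrite eq_complex /=.
    by apply/andP; split; apply/eqP; ring.
  under eq_Rintegral do rewrite E /= mul0r subr0.
  under [X in (_ +i* X)%C]eq_Rintegral do rewrite E /= mul0r addr0.
  rewrite !RintegralZl //; try exact: integrable_bounded_set DM _.
  by apply/eqP; rewrite eq_complex /= !mul0r subr0 addr0 !eqxx.
have := orth _ _ Lla Lla'; rewrite (negbTE neq) innerE => /eqP.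
rewrite mulf_eq0 => /orP[|/eqP//].
(* The normalising factor cannot vanish, since each basis vector has inner product 1 with itself. *)
have := orth _ _ Lla Lla; rewrite eqxx innerE => /[swap] /eqP->.
by rewrite mul0r => /eqP; rewrite eq_sym oner_eq0.
Qed.

(** The constant is 1/(2 pi i la), from the antiderivative of the exponential; real and imaginary
    parts are integrated separately. *)
Lemma cintegral_expchar_oo (la a b : R) : la != 0 -> a < b ->
  cintegral `]a, b[ (expchar la) =
  - 'i%C * ((2 * pi * la)^-1)%:C%C * (expchar la b - expchar la a).
Proof.
move=> la0 ab; set t := 2 * pi * la.
have t0 : t != 0 by rewrite !mulf_neq0 // gt_eqF // pi_gt0.
have dt x : is_derive x (1 : R) (fun y : R => t * y) t.
  by apply: is_derive_eq; rewrite -[_ *: _]/(_ * _) mulr1.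
have intcos : \int[mu]_(x in `]a, b[) cos (t * x) =
    t^-1 * sin (t * b) - t^-1 * sin (t * a).
  apply: (@Rintegral_oo_FTC2 _ _ (fun x => t^-1 * sin (t * x))) => // x.
    exact: continuous_cos_mull.
  apply: is_derive_eq.
  by rewrite -[_ *: _]/(_ * _); field.
have intsin : \int[mu]_(x in `]a, b[) sin (t * x) =
    - t^-1 * cos (t * b) - - t^-1 * cos (t * a).
  apply: (@Rintegral_oo_FTC2 _ _ (fun x => - t^-1 * cos (t * x))) => // x.
    exact: continuous_sin_mull.
  apply: is_derive_eq.
  by rewrite -[_ *: _]/(_ * _); field.
rewrite /cintegral /= -/t intcos intsin.
apply/eqP; rewrite eq_complex /= -/t; apply/andP; split; apply/eqP; ring.
Qed.

Lemma cintegral_bigcup_expchar n (a b : 'I_n -> R) (la : R) :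
  la != 0 -> (forall i, a i < b i) ->
  trivIset setT (fun i => [set` `]a i, b i[]) ->
  cintegral (\bigcup_(i in setT) [set` `]a i, b i[]) (expchar la) =
  - 'i%C * ((2 * pi * la)^-1)%:C%C *
    (\sum_i expchar la (b i) - \sum_i expchar la (a i)).
Proof.
move=> la0 ab tI; rewrite -sumrB big_distrr /=.
under eq_bigr do rewrite -cintegral_expchar_oo //.
have ccos : continuous (fun x : R => cos (2 * pi * la * x)).
  exact: continuous_cos_mull.
have csin : continuous (fun x : R => sin (2 * pi * la * x)).
  exact: continuous_sin_mull.
have int i f : continuous f -> mu.-integrable `]a i, b i[ (EFin \o f).
  apply: (@integrable_bounded_set _ _ _ (`|a i| + `|b i|)) => // x /=.
  rewrite !in_itv /= => /andP[ax xb].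
  have := ler_norm (b i); have := ler_norm (- a i); rewrite normrN.
  have := normr_ge0 (a i); have := normr_ge0 (b i).
  by move=> h1 h2 h3 h4; apply/andP; split; lra.
rewrite /cintegral /= !Rintegral_bigcup_ord //; last first.
- exact: continuous_measurable_fun.
- by move=> i; exact: int.
- exact: continuous_measurable_fun.
- by move=> i; exact: int.
by apply/esym; elim/big_rec3: _ => // i x y z _ ->.
Qed.

Lemma spectrum_period_endpoints n (a b : 'I_n -> R) L (p : R) :
  (0 < n)%N -> (forall i, a i < b i) ->
  trivIset setT (fun i => [set` `]a i, b i[]) ->
  is_spectrum (\bigcup_(i in setT) [set` `]a i, b i[]) L -> has_period L p ->
  forall m, \sum_i expchar p (b i) ^+ m = \sum_i expchar p (a i) ^+ m.
Proof.
(* For exponent 0 both sums count the [n] intervals; orthogonality needs two distinct frequencies,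
   hence a positive exponent. *)
move=> n0 ab tI spec [p0 per] [|m]; first by under eq_bigr do rewrite expr0.
set D := \bigcup_(i in _) _ in spec.
have mD : measurable D.
  by apply: fin_bigcup_measurable => //; exact: finite_finset.
pose M := \sum_i (`|a i| + `|b i|).
have DM : D `<=` `[-M, M].
  move=> x [i _ /=]; rewrite !in_itv /= => /andP[ax xb].
  have : `|a i| + `|b i| <= M.
    by rewrite /M (bigD1 i) //= lerDl sumr_ge0 // => j _; rewrite addr_ge0.
  have := ler_norm (b i); have := ler_norm (- a i); rewrite normrN.
  have := normr_ge0 (a i); have := normr_ge0 (b i).
  by move=> h1 h2 h3 h4 h5; apply/andP; split; lra.
have Dgt0 : (0 < mu D)%E.
  pose i0 := Ordinal n0.
  apply: (@lt_le_trans _ _ (mu `]a i0, b i0[)); last first.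
    by apply: le_measure; rewrite ?inE // => x xi; exists i0.
  by rewrite lebesgue_measure_itv /= lte_fin ab -EFinB lte_fin subr_gt0.
have Dlty : (mu D < +oo)%E.
  apply: (@le_lt_trans _ _ (mu `[-M, M])).
    by apply: le_measure; rewrite ?inE.
  by rewrite lebesgue_measure_itv /=; case: ifP; rewrite -?EFinB ltry.
have [|la Lla] := spectrum_nonempty _ _ mD _ spec; first by rewrite Dgt0.
have Lp k : L (la + p *+ k).
  elim: k => [|k IH]; first by rewrite addr0.
  by rewrite mulrSr addrA -per; exists (la + p *+ k).
have pm0 : p *+ m.+1 != 0 by rewrite mulrn_eq0.
(* The two frequencies differ by [p *+ m.+1], and the exponential of that frequency is a power of
   the one of frequency [p]. *)
have := spectrum_orthogonal _ _ _ _ _ mD DM spec (Lp m.+1) Lla.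
rewrite -subr_eq0 addrAC subrr add0r => /(_ pm0).
rewrite cintegral_bigcup_expchar // => /eqP.
rewrite mulf_eq0 (negbTE (_ : _ * _ != 0)) /=; last first.
  rewrite mulf_neq0 // ?oppr_eq0 ?neq0Ci // eq_complex /= eqxx andbT.
  by rewrite invr_eq0 !mulf_neq0 // gt_eqF // pi_gt0.
rewrite subr_eq0 => /eqP.
under eq_bigr do rewrite expchar_natl.
by under [RHS]eq_bigr do rewrite expchar_natl.
Qed.

End Spectrum.

(** * Ordered intervals, the lattice (1/p)Z, and the conclusion *)

Lemma ordered_itv_lt (R : realDomainType) (n : nat) (a b : 'I_n -> R) :
  (forall i, a i < b i) ->
  (forall i j : 'I_n, j = i.+1 :> nat -> b i < a j) ->
  forall i j : 'I_n, (i < j)%N -> b i < a j.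
Proof.
move=> ab ba i [j jn] /=; elim: j jn => // j IH jn.
rewrite ltnS leq_eqVlt => /orP[/eqP ij|ij]; first by apply: ba; rewrite /= ij.
have jn' := ltnW jn.
apply: lt_trans (IH jn' ij) _; apply: lt_trans (ab _) _.
exact: ba.
Qed.

Lemma ordered_itv_trivIset (R : realDomainType) (n : nat) (a b : 'I_n -> R) :
  (forall i, a i < b i) ->
  (forall i j : 'I_n, j = i.+1 :> nat -> b i < a j) ->
  trivIset setT (fun i => [set` `]a i, b i[]).
Proof.
move=> ab ba i j _ _ [x [/=]]; rewrite !in_itv /= => /andP[i1 i2] /andP[j1 j2].
apply: val_inj; have lt := @ordered_itv_lt _ _ _ _ ab ba.
by case: (ltngtP i j) => // /lt h; exfalso; lra.
Qed.

Lemma inv_lattice_sub (R : realType) (p x y : R) :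
  inv_lattice p x -> inv_lattice p y -> inv_lattice p (x - y).
Proof.
by move=> [z _ <-] [w _ <-]; exists (z - w) => //; rewrite intrB mulrBl.
Qed.

Lemma inv_lattice_unbounded (R : realType) (p B : R) : p != 0 ->
  exists2 q, inv_lattice p q & B <= q.
Proof.
(* Dividing by a negative [p] reverses the order, so the ceiling gives way to the floor. *)
move=> p0; have [pp|pn|p00] := ltgtP 0 p; last by rewrite -p00 eqxx in p0.
- exists ((Num.ceil (B * p))%:~R / p); first by exists (Num.ceil (B * p)).
  by rewrite ler_pdivlMr // ceil_ge.
- exists ((Num.floor (B * p))%:~R / p); first by exists (Num.floor (B * p)).
  by rewrite ler_ndivlMr // floor_le.
Qed.

Theorem corollary4p10 (R : realType) (n : nat) (alpha beta : 'I_n -> R) (p : R)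
    (n_gt0 : (0 < n)%N)
    (alpha_lt_beta : forall i, alpha i < beta i)
    (beta_lt_alpha : forall i j : 'I_n, j = i.+1 :> nat -> beta i < alpha j)
    (spectrum_period : exists L : set R,
       is_spectrum (\bigcup_(i in [set: 'I_n]) [set` `]alpha i, beta i[]) L /\
       has_period L p) :
  exists k : 'I_n -> R,
    [/\ forall i, inv_lattice p (k i),
        trivIset [set: 'I_n]
          (fun i => [set` `[alpha i - k i, beta i - k i[]) &
        exists (m : nat) (a b : 'I_m -> R),
          [/\ forall j, a j < b j,
              forall j, inv_lattice p (b j - a j),
              trivIset [set: 'I_m] (fun j => [set` `[a j, b j[]) &
              \bigcup_(i in [set: 'I_n])
                 [set` `[alpha i - k i, beta i - k i[] =
              \bigcup_(j in [set: 'I_m]) [set` `[a j, b j[]]].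
Proof.
have [L [spec per]] := spectrum_period.
have p0 := per.1.
have power_sums := spectrum_period_endpoints _ _ _ _ _ _ n_gt0 alpha_lt_beta
  (ordered_itv_trivIset _ _ _ _ alpha_lt_beta beta_lt_alpha) spec per.
(* Equality as multisets of points on the circle provides [sigma], matching each [beta i] with
   [alpha (sigma i)]. *)
have /tuple_permP[sigma /val_inj sigmaE] :
    perm_eq [tuple expchar p (beta i) | i < n]
            [tuple expchar p (alpha i) | i < n].
  apply: power_sums_perm_eq => m; rewrite !big_map -!enumT !big_enum.
  exact: power_sums.
apply: (rearrange_along_cycles _ _ _ _ _ alpha beta sigma) => //.
- exact: inv_lattice_sub.
- by move=> B; exact: inv_lattice_unbounded.
- move=> i; apply: expchar_inj => //.
  by have /(congr1 (fun u => tnth u i)) := sigmaE; rewrite !tnth_mktuple.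
Qed.
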